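(* Let $X$ be a totally ordered set with $|X|\geq 2$ and let $\mathcal{B} \subset \mathrm{Br}(X)$ be the Hall set of the Lyndon basis. For every $a < b \in \mathcal{B}$, $$\| [a, b] \|_{\mathcal{B}} \leq 2^{|b|-1}.$$
   Context: The base field is $\mathbb{K}=\mathbb{R}$ or $\mathbb{C}$; $X$ is a set (possibly infinite) with at least two elements. $\mathrm{Br}(X)$ is the free magma over $X$: the set of formal binary brackets (rooted planar binary trees with leaves labelled by elements of $X$), with product $(t_1,t_2)$. For $t\in \mathrm{Br}(X)$, $|t|$ is its number of leaves; if $t\notin X$, $t$ is written uniquely as $t=(\lambda(t),\mu(t))$. $\mathcal{L}(X)$ is the free Lie algebra over $X$ and $\mathrm{ev}:\mathrm{Br}(X)\to\mathcal{L}(X)$ is the canonical evaluation ($\mathrm{ev}(x)=x$ for $x\in X$, $\mathrm{ev}((t_1,t_2))=[\mathrm{ev}(t_1),\mathrm{ev}(t_2)]$). For $a,b\in\mathrm{Br}(X)$, $[a,b]$ denotes $[\mathrm{ev}(a),\mathrm{ev}(b)]\in\mathcal{L}(X)$. A Hall set is a subset $\mathcal{B}\subset\mathrm{Br}(X)$ endowed with a total order $<$ such that: (i) $X\subset\mathcal{B}$; (ii) for all $b_1,b_2\in\mathrm{Br}(X)$, $(b_1,b_2)\in\mathcal{B}$ iff $b_1,b_2\in\mathcal{B}$, $b_1<b_2$ and either $b_2\in X$ or $\lambda(b_2)\leq b_1$; (iii) for all $b_1,b_2\in\mathcal{B}$ with $(b_1,b_2)\in\mathcal{B}$, $b_1<(b_1,b_2)$.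 By a theorem of Viennot, $\mathrm{ev}$ is injective on $\mathcal{B}$ and $\mathrm{ev}(\mathcal{B})$ is a basis of $\mathcal{L}(X)$. For $u=\sum_{c\in\mathcal{B}}\alpha_c\,\mathrm{ev}(c)\in\mathcal{L}(X)$ (finite sum), $\|u\|_{\mathcal{B}}:=\sum_{c}|\alpha_c|$. Lyndon basis: $X$ is totally ordered and the free monoid $X^*$ carries the induced lexicographic order. A word $w\in X^*$ is a Lyndon word if $w\in X$, or if $w<vu$ for every factorization $w=uv$ into nonempty words. The standard factorization of a Lyndon word $w\notin X$ is the factorization $w=uv$ with $u,v$ Lyndon words and $u$ of maximal length. Define $\mathrm{br}$ from Lyndon words to $\mathrm{Br}(X)$ by $\mathrm{br}(x)=x$ for $x\in X$ and $\mathrm{br}(w)=(\mathrm{br}(u),\mathrm{br}(v))$ for $w=uv$ the standard factorization. The set $\mathcal{B}$ of all $\mathrm{br}(w)$, $w$ Lyndon, ordered by the lexicographic order on the foliage (the word read on the leaves), is a Hall set (known fact), called the Hall set of the Lyndon basis. *)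

(* Defs.v *)
From HB Require Import structures.
From mathcomp Require Import all_boot all_order all_algebra.
From mathcomp Require Import finmap complex.
From mathcomp Require Import boolp classical_sets reals constructive_ereal.

Set Implicit Arguments.
Unset Strict Implicit.
Unset Printing Implicit Defensive.

Import Order.TTheory GRing.Theory Num.Theory.

Local Open Scope ring_scope.

(* With [R : realType], these are the fields of real and complex numbers;
   [numFieldType] provides the absolute value (valued in [K] itself). *)
Variant real_or_complex (R : realType) : numFieldType -> Prop :=
  | base_real : real_or_complex R R
  | base_complex : real_or_complex R R[i].

HB.mixin Record Lmodule_isLieAlgebra (K : numFieldType) (L : Type)
    of GRing.Lmodule K L := {
  lie : L -> L -> L;
  lie_linearl : forall z : L, linear (fun x => lie x z);
  lie_linearr : forall z : L, linear (fun x => lie z x);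
  lie_alternating : forall x : L, lie x x = 0;
  lie_jacobi : forall x y z : L,
    lie x (lie y z) + lie y (lie z x) + lie z (lie x y) = 0
}.

#[short(type="lieAlgType")]
HB.structure Definition LieAlgebra (K : numFieldType) :=
  { L of GRing.Lmodule K L & Lmodule_isLieAlgebra K L }.

Definition lie_morphism (K : numFieldType) (L M : lieAlgType K)
    (phi : L -> M) : Prop :=
  linear phi /\ {morph phi : x y / lie x y}.

(* [L] with [i : X -> L] is the free Lie algebra over the set [X]
   (determined up to unique isomorphism). *)
Definition is_free_lie_algebra (K : numFieldType) (X : Type)
    (L : lieAlgType K) (i : X -> L) : Prop :=
  forall (M : lieAlgType K) (f : X -> M),
    exists! phi : L -> M, lie_morphism phi /\ forall x, phi (i x) = f x.

Inductive Br (X : Type) : Type :=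
  | Leaf of X
  | Node of Br X & Br X.

Section BrChoice.
Variable X : choiceType.

Fixpoint tree_of_Br (t : Br X) : GenTree.tree X :=
  match t with
  | Leaf x => GenTree.Leaf x
  | Node t1 t2 => GenTree.Node 0 [:: tree_of_Br t1; tree_of_Br t2]
  end.

Fixpoint Br_of_tree (t : GenTree.tree X) : option (Br X) :=
  match t with
  | GenTree.Leaf x => Some (Leaf x)
  | GenTree.Node _ [:: t1; t2] =>
      if (Br_of_tree t1, Br_of_tree t2) is (Some b1, Some b2)
      then Some (Node b1 b2) else None
  | _ => None
  end.

Lemma tree_of_BrK : pcancel tree_of_Br Br_of_tree.
Proof. by elim=> //= t1 -> t2 ->. Qed.

HB.instance Definition _ := Choice.copy (Br X) (pcan_type tree_of_BrK).

End BrChoice.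

Fixpoint leaves (X : Type) (t : Br X) : nat :=
  match t with
  | Leaf _ => 1
  | Node t1 t2 => (leaves t1 + leaves t2)%N
  end.

Fixpoint foliage (X : Type) (t : Br X) : seq X :=
  match t with
  | Leaf x => [:: x]
  | Node t1 t2 => foliage t1 ++ foliage t2
  end.

Fixpoint ev (K : numFieldType) (X : Type) (L : lieAlgType K) (i : X -> L)
    (t : Br X) : L :=
  match t with
  | Leaf x => i x
  | Node t1 t2 => lie (ev i t1) (ev i t2)
  end.

Section Lyndon.
Variables (d : Order.disp_t) (X : orderType d).

(* Lexicographic order on words; a proper prefix is smaller. *)
Definition lex_lt (u v : seq X) : bool := ((u : seqlexi X) < (v : seqlexi X))%O.

(* Words of length 1 satisfy the second condition vacuously. *)
Definition lyndon (w : seq X) : Prop :=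
  w <> [::] /\
  forall u v : seq X, u <> [::] -> v <> [::] -> w = u ++ v ->
    lex_lt w (v ++ u).

(* The left factor [u] is the longest one. *)
Definition standard_factorization (w u v : seq X) : Prop :=
  [/\ w = u ++ v, lyndon u, lyndon v &
      forall u' v' : seq X, w = u' ++ v' -> lyndon u' -> lyndon v' ->
        (size u' <= size u)%N].

(* Graph of the map br from Lyndon words to brackets. *)
Inductive br_graph : seq X -> Br X -> Prop :=
  | br_letter (x : X) : br_graph [:: x] (Leaf x)
  | br_factor (w u v : seq X) (t1 t2 : Br X) :
      lyndon w -> standard_factorization w u v ->
      br_graph u t1 -> br_graph v t2 -> br_graph w (Node t1 t2).

Definition lyndon_basis : set (Br X) :=
  [set t | exists2 w, lyndon w & br_graph w t]%classic.

Definition br_lt (a b : Br X) : bool := lex_lt (foliage a) (foliage b).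

End Lyndon.

Section Norm.
Variables (K : numFieldType) (X : choiceType) (L : lieAlgType K) (i : X -> L).
Variable B : set (Br X).

Definition expansion (u : L) (alpha : {fsfun Br X -> K with 0}) : Prop :=
  (forall c : Br X, c \in finsupp alpha -> B c) /\
  u = \sum_(c <- finsupp alpha) alpha c *: ev i c.

(* The l^1 norm of the coordinates of [u] in ev(B). When ev is injective on [B]
   and ev(B) is a basis of [L], the expansion exists and is unique; the value
   +oo is taken only if [u] is not in the linear span of ev(B). *)
Definition basis_norm (u : L) : \bar K :=
  match pselect (exists alpha, expansion u alpha) with
  | left h =>
      let alpha := sval (cid h) in (\sum_(c <- finsupp alpha) `|alpha c|)%:E
  | right _ => +oo%E
  end.

End Norm.

(* Main.v *)
From HB Require Import structures.
Require Import Defs.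
From mathcomp Require Import all_boot all_order all_algebra ring.
From mathcomp Require Import finmap boolp classical_sets functions.
From mathcomp Require Import reals constructive_ereal.

(** The bound follows from Jacobi, [a, [b1, b2]] = [[a, b1], b2] + [b1, [a, b2]],
by induction on the bracket b = (b1, b2) whenever (a, b) is not itself in the
basis, i.e. when a < b1 = lambda(b).  For the recursion to close with factor 2
one controls the support of [a, b]: each c in it is smaller than b (and not a
prefix of b) and satisfies lambda(c) <= max(a, lambda(b)).  Hence every c in the
support of [a, b1] is below b2, so that [c, b2] costs 2^(|b2|-1); and every c in
the support of [a, b2] has lambda(c) <= b1, so that either (b1, c) is in the
basis, or c <= b1 and [b1, c] = -[c, b1] costs 2^(|b1|-1).

That the coordinates bounded in this way are the coordinates follows from linear
independence: in the Lie algebra of noncommutative power series, the evaluation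
of br(w) is w plus lexicographically larger words of the same length. *)

Set Implicit Arguments.
Unset Strict Implicit.
Unset Printing Implicit Defensive.

Import Order.TTheory GRing.Theory Num.Theory.
Local Open Scope ring_scope.

(** * The Lie algebra of noncommutative power series *)

Section Convolution.
Variables (K : numFieldType) (X : Type).
Implicit Types (f g h : seq X -> K) (w u v : seq X).

(** The Cauchy product: the sum of [f u * g v] over all splittings [w = u ++ v], the letters of [u]
    being absorbed into [f] one at a time. *)
Fixpoint conv f g w : K :=
  if w is x :: w' then f [::] * g w + conv (fun u => f (x :: u)) g w'
  else f [::] * g [::].

Lemma conv_lin_l k f1 f2 g w :
  conv (fun u => k * f1 u + f2 u) g w = k * conv f1 g w + conv f2 g w.
Proof. by elim: w f1 f2 => [|x w IH] f1 f2 /=; rewrite ?IH; ring. Qed.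

Lemma conv_lin_r k f g1 g2 w :
  conv f (fun u => k * g1 u + g2 u) w = k * conv f g1 w + conv f g2 w.
Proof. by elim: w f => [|x w IH] f /=; rewrite ?IH; ring. Qed.

(** Shifting [conv f g] past a first letter gives a multiple of a shift of [g] plus a convolution,
    which [conv_lin_l] separates. *)
Lemma convA f g h w : conv f (conv g h) w = conv (conv f g) h w.
Proof.
elim: w f => [|x w IH] f /=; first exact: mulrA.
by rewrite IH conv_lin_l; ring.
Qed.

(** Homogeneity of degree [n]. If the left factor of a product is homogeneous, at most one splitting
    of each word contributes. *)
Definition vanishes_off (n : nat) f := forall w, size w != n -> f w = 0.

Lemma conv0l f g w : (forall u, f u = 0) -> conv f g w = 0.
Proof. by elim: w f => [|x w IH] f f0 /=; rewrite f0 ?IH // !mul0r ?addr0. Qed.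

Lemma conv_cat n f g u v : vanishes_off n f -> size u = n ->
  conv f g (u ++ v) = f u * g v.
Proof.
elim: u n f => [|x u IH] n f fn /= un.
  case: v => [|y v] //=; rewrite conv0l ?addr0 // => t.
  by rewrite fn // -un.
rewrite fn -?un // mul0r add0r (IH (size u)) // => t tu.
by rewrite fn // -un eqSS.
Qed.

Lemma conv_short n f g w : vanishes_off n f -> (size w < n)%N -> conv f g w = 0.
Proof.
elim: w n f => [|x w IH] [|n] f fn //= wn; rewrite fn ?mul0r ?add0r //.
by apply: (IH n) => // t tn; rewrite fn.
Qed.

Lemma conv_vanishes_off m n f g : vanishes_off m f -> vanishes_off n g ->
  vanishes_off (m + n) (conv f g).
Proof.
move=> fm gn w wmn; case: (ltnP (size w) m) => [wm|mw].
  exact: conv_short wm.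
rewrite -(cat_take_drop m w) (conv_cat _ _ fm) ?size_takel //.
rewrite gn ?mulr0 // size_drop; apply: contraNneq wmn => <-.
by rewrite subnKC.
Qed.

(** [K^o] is [K] as a module over itself, so functions into it carry the pointwise module
    structure. *)
Definition series := seq X -> K^o.
HB.instance Definition _ := GRing.Lmodule.on series.

Definition commutator (f g : series) : series :=
  fun w => conv f g w - conv g f w.

Fact commutator_linearl g : linear (commutator^~ g).
Proof.
move=> k f1 f2; apply/funext => w.
have -> : commutator (k *: f1 + f2) g w
  = conv (fun u => k * f1 u + f2 u) g w - conv g (fun u => k * f1 u + f2 u) w by [].
have -> : (k *: commutator f1 g + commutator f2 g) w
  = k * commutator f1 g w + commutator f2 g w by [].
by rewrite conv_lin_l conv_lin_r /commutator; ring.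
Qed.

Fact commutator_linearr f : linear (commutator f).
Proof.
move=> k g1 g2; apply/funext => w.
have -> : commutator f (k *: g1 + g2) w
  = conv f (fun u => k * g1 u + g2 u) w - conv (fun u => k * g1 u + g2 u) f w by [].
have -> : (k *: commutator f g1 + commutator f g2) w
  = k * commutator f g1 w + commutator f g2 w by [].
by rewrite conv_lin_l conv_lin_r /commutator; ring.
Qed.

Fact commutator_alternating f : commutator f f = 0.
Proof. by apply/funext => w; rewrite /commutator subrr. Qed.

Lemma conv_commutator_r f g h w :
  conv f (commutator g h) w = conv f (conv g h) w - conv f (conv h g) w.
Proof.
have -> : commutator g h = (fun u => -1 * conv h g u + conv g h u).
  by apply/funext => u; rewrite /commutator; ring.
by rewrite conv_lin_r; ring.
Qed.

Lemma conv_commutator_l f g h w :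
  conv (commutator g h) f w = conv (conv g h) f w - conv (conv h g) f w.
Proof.
have -> : commutator g h = (fun u => -1 * conv h g u + conv g h u).
  by apply/funext => u; rewrite /commutator; ring.
by rewrite conv_lin_l; ring.
Qed.

Fact commutator_jacobi f g h :
  commutator f (commutator g h) + commutator g (commutator h f)
    + commutator h (commutator f g) = 0.
Proof.
apply/funext => w.
have -> : (commutator f (commutator g h) + commutator g (commutator h f)
    + commutator h (commutator f g)) w = commutator f (commutator g h) w
    + commutator g (commutator h f) w + commutator h (commutator f g) w by [].
have -> : (0 : series) w = 0 by [].
rewrite [commutator f _ w]/commutator [commutator g _ w]/commutator.
rewrite [commutator h _ w]/commutator.
rewrite !conv_commutator_r !conv_commutator_l !convA; ring.
Qed.

HB.instance Definition _ := Lmodule_isLieAlgebra.Build K series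
  commutator_linearl commutator_linearr commutator_alternating
  commutator_jacobi.

End Convolution.

(** * Lexicographic order on words *)

Section Words.
Variables (d : Order.disp_t) (X : orderType d).
Implicit Types (u v w x y e : seq X) (s t : seq (seq X)).

Lemma lex_lt_cons a u b v :
  lex_lt (a :: u) (b :: v) = (a < b)%O || (a == b) && lex_lt u v.
Proof. by rewrite /lex_lt ltxi_cons; case: (ltgtP a b). Qed.

Lemma lex_lt_s0 u : lex_lt u [::] = false. Proof. exact: ltxis0. Qed.
Lemma lex_lt_0s u : lex_lt [::] u = (u != [::]). Proof. exact: ltxi0s. Qed.

Lemma lex_ltxx u : lex_lt u u = false.
Proof. exact: ltxx. Qed.

Lemma lex_lt_trans v u w : lex_lt u v -> lex_lt v w -> lex_lt u w.
Proof. exact: lt_trans. Qed.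

Lemma lex_lt_asym u v : lex_lt u v -> lex_lt v u -> False.
Proof. by move=> uv /(lex_lt_trans uv); rewrite lex_ltxx. Qed.

Lemma lex_lt_total u v : [\/ lex_lt u v, u = v | lex_lt v u].
Proof.
rewrite /lex_lt; case: (ltgtP (u : seqlexi X) v) => [||->].
- by constructor 1.
- by constructor 3.
- by constructor 2.
Qed.

Lemma lex_lt_cat2l u v w : lex_lt (u ++ v) (u ++ w) = lex_lt v w.
Proof. by elim: u => //= a u IH; rewrite lex_lt_cons ltxx eqxx. Qed.

Lemma lex_lt_catr u v : v <> [::] -> lex_lt u (u ++ v).
Proof.
by move=> v0; rewrite -{1}(cats0 u) lex_lt_cat2l lex_lt_0s; apply/eqP.
Qed.

Definition lex_le u v := ~~ lex_lt v u.

Lemma lex_le_eqVlt u v : lex_le u v -> u = v \/ lex_lt u v.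
Proof.
by rewrite /lex_le; case: (lex_lt_total u v); [right | left | move=> ->].
Qed.

Lemma lex_ltW u v : lex_lt u v -> lex_le u v.
Proof. by move=> uv; apply/negP => /(lex_lt_asym uv). Qed.

Lemma lex_lexx u : lex_le u u. Proof. by rewrite /lex_le lex_ltxx. Qed.

Lemma lex_le_lt_trans v u w : lex_le u v -> lex_lt v w -> lex_lt u w.
Proof. by case/lex_le_eqVlt => [->|] // uv; apply: lex_lt_trans. Qed.

Lemma lex_lt_le_trans v u w : lex_lt u v -> lex_le v w -> lex_lt u w.
Proof. by move=> uv /lex_le_eqVlt [<-|] //; apply: lex_lt_trans. Qed.

Lemma lex_le_trans v u w : lex_le u v -> lex_le v w -> lex_le u w.
Proof. by case/lex_le_eqVlt => [->|] // uv /(lex_lt_le_trans uv)/lex_ltW. Qed.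

Lemma lex_le_cat u v : lex_le u (u ++ v).
Proof.
by case: v => [|a v]; rewrite ?cats0 ?lex_lexx //; apply/lex_ltW/lex_lt_catr.
Qed.

(* The comparison is decided by a letter, hence is stable under appending words
   on either side. *)
Definition lex_ll u v := lex_lt u v && ~~ prefix u v.

Lemma lex_ll_cons a u b v :
  lex_ll (a :: u) (b :: v) = (a < b)%O || (a == b) && lex_ll u v.
Proof.
rewrite /lex_ll lex_lt_cons prefix_cons; case: ltgtP => //= _.
Qed.

Lemma lex_ll_s0 u : lex_ll u [::] = false.
Proof. by rewrite /lex_ll lex_lt_s0. Qed.

Lemma lex_ll_0s u : lex_ll [::] u = false.
Proof. by rewrite /lex_ll prefix0s andbF. Qed.

Lemma lex_llW u v : lex_ll u v -> lex_lt u v. Proof. by case/andP. Qed.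

Lemma lex_ll_size u v : lex_lt u v -> (size v < size u)%N -> lex_ll u v.
Proof.
move=> uv vu; rewrite /lex_ll uv; apply/negP => /size_prefix.
by rewrite leqNgt vu.
Qed.

Lemma lex_ll_cat u v x y : lex_ll u v -> lex_ll (u ++ x) (v ++ y).
Proof.
elim: u v => [|a u IH] [|b v]; rewrite ?lex_ll_0s ?lex_ll_s0 //=.
by rewrite !lex_ll_cons => /orP [->//|/andP[-> /IH ->]]; rewrite orbT.
Qed.

Lemma lex_ll_catl x u v : lex_ll u v -> lex_ll (u ++ x) v.
Proof. by move=> /(lex_ll_cat x [::]); rewrite cats0. Qed.

Lemma lex_ll_catr y u v : lex_ll u v -> lex_ll u (v ++ y).
Proof. by move=> /(lex_ll_cat [::] y); rewrite cats0. Qed.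

Lemma lex_ll_cat2l u v w : lex_ll (u ++ v) (u ++ w) = lex_ll v w.
Proof. by elim: u => //= a u IH; rewrite lex_ll_cons ltxx eqxx. Qed.

Lemma lex_ltP u v :
  lex_lt u v -> lex_ll u v \/ exists2 y, y <> [::] & v = u ++ y.
Proof.
move=> uv; rewrite /lex_ll uv; case: (boolP (prefix u v)) => [|_]; last by left.
case/prefixP => y vE; right; exists y => // y0.
by move: uv; rewrite vE y0 cats0 lex_ltxx.
Qed.

(** A deciding letter survives when the right-hand word grows. It need not survive when the
    left-hand word decreases, since that may produce a prefix. *)
Lemma lex_ll_le_trans v u w : lex_ll u v -> lex_le v w -> lex_ll u w.
Proof.
elim: u v w => [|a u IH] [|b v] w; rewrite ?lex_ll_0s ?lex_ll_s0 //.
case: w => [|c w]; first by rewrite /lex_le lex_lt_0s.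
rewrite !lex_ll_cons /lex_le lex_lt_cons negb_or negb_and -leNgt.
case/orP => [ab /andP[bc _]|/andP[/eqP-> uv]].
  by rewrite (lt_le_trans ab bc).
by case: ltgtP => //= bc vw; apply: IH vw.
Qed.

(** * Lyndon words and their factorizations *)

Lemma lyndon_neq0 w : lyndon w -> w <> [::]. Proof. by case. Qed.

Lemma cat_neq0l u v : u <> [::] -> u ++ v <> [::].
Proof. by case: u. Qed.

Lemma cat_eq_cat u v x y : u ++ v = x ++ y -> (size u <= size x)%N ->
  exists2 z, x = u ++ z & v = z ++ y.
Proof.
move=> E ux; have Ex : take (size u) (u ++ v) = take (size u) (x ++ y).
  by rewrite E.
rewrite take_size_cat // takel_cat // in Ex.
exists (drop (size u) x); first by rewrite {1}Ex cat_take_drop.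
have := congr1 (drop (size u)) E; rewrite drop_size_cat // => ->.
rewrite drop_cat; case: ltngtP ux => // ->.
by rewrite subnn drop0 drop_size.
Qed.

(** If the suffix [v] of [w = u ++ v] were below [w], then [w < v ++ u] would force [w = v ++ t]
    with [t < u] of equal length. Hence [t ++ v < u ++ v = w], against the rotation condition for
    [v ++ t]. *)
Lemma lyndon_suffixP w :
  lyndon w <-> w <> [::] /\ forall u v, u <> [::] -> v <> [::] ->
    w = u ++ v -> lex_lt w v.
Proof.
split=> -[w0 H]; split=> // u v u0 v0 wE; last first.
  exact: lex_lt_trans (H _ _ u0 v0 wE) (lex_lt_catr _ u0).
have wvu := H _ _ u0 v0 wE.
case: (lex_lt_total w v) => [//|wv|].
  by case: u0; apply/nilP; rewrite /nilp -(eqn_add2r (size v)) -size_cat -wE wv.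
case/lex_ltP => [/(lex_ll_catl u)/lex_llW /(lex_lt_asym wvu)//|[t t0 wvt]].
have szt : size t = size u.
  by apply/eqP; rewrite -(eqn_add2l (size v)) -size_cat -wvt wE size_cat addnC.
have tu : lex_lt t u by rewrite wvt lex_lt_cat2l in wvu.
have wtv := H _ _ v0 t0 wvt; rewrite wE in wtv.
case/lex_ltP: tu => [/(lex_ll_cat v v)/lex_llW /(lex_lt_asym wtv)//|[y y0 uE]].
by move: szt; rewrite uE size_cat -[LHS]addn0 => /addnI/esym/size0nil.
Qed.

Lemma lyndon_letter (a : X) : lyndon [:: a].
Proof. by split=> // -[|b [|c u]] [|e v]. Qed.

Lemma lyndon_lt_suffix u v : lyndon (u ++ v) -> u <> [::] -> v <> [::] ->
  lex_lt (u ++ v) v.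
Proof. by case/lyndon_suffixP => _ H u0 v0; apply: H erefl. Qed.

Lemma lyndon_cat_lt u v : lyndon u -> lyndon v -> lex_lt u v ->
  lex_lt (u ++ v) v.
Proof.
move=> /lyndon_neq0 u0 lv /lex_ltP[/(lex_ll_catl v)/lex_llW//|[y y0 vE]].
rewrite {2}vE lex_lt_cat2l vE; apply: lyndon_lt_suffix => //.
by rewrite -vE.
Qed.

(** A suffix starting inside [u] begins with a proper suffix of [u], which is larger than [u] and
    shorter, hence larger by a letter. A suffix of [v] is at least [v], which exceeds [u ++ v]. *)
Lemma lyndon_cat u v : lyndon u -> lyndon v -> lex_lt u v -> lyndon (u ++ v).
Proof.
move=> lu lv uv; have uvv := lyndon_cat_lt lu lv uv.
have u0 := lyndon_neq0 lu; have v0 := lyndon_neq0 lv.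
apply/lyndon_suffixP; split=> [|x y x0 y0]; first exact: cat_neq0l.
case: (ltnP (size x) (size u)) => [xu|ux] uvE.
  have [z uE yE] := cat_eq_cat (esym uvE) (ltnW xu).
  have z0 : z <> [::].
    by move=> z0; move: xu; rewrite uE z0 cats0 ltnn.
  have uz : lex_ll u z.
    apply: lex_ll_size; first by rewrite uE; apply: lyndon_lt_suffix; rewrite -?uE.
    rewrite uE size_cat -[X in (X < _)%N]add0n ltn_add2r.
    by case: (x) x0.
  by rewrite yE; apply: lex_llW; apply: lex_ll_cat.
have [z xE vE] := cat_eq_cat uvE ux.
case: (altP (z =P [::])) => [z0|/eqP z0]; first by rewrite vE z0 in uvv *.
apply: lex_lt_trans uvv _; rewrite vE; apply: lyndon_lt_suffix => //.
by rewrite -vE.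
Qed.

Definition nonincreasing_lyndon s :=
  (forall w, w \in s -> lyndon w) /\ pairwise (fun u v => lex_le v u) s.

(** As long as [u] is smaller than the first factor it absorbs it, which [lyndon_cat] permits. *)
Lemma nonincreasing_lyndon_insert u s : lyndon u -> nonincreasing_lyndon s ->
  exists2 t, nonincreasing_lyndon t & flatten t = u ++ flatten s.
Proof.
elim: s u => [|v s IH] u lu [ls ps].
  by exists [:: u] => //=; split=> // w; rewrite inE => /eqP->.
have lv : lyndon v by apply: ls; rewrite inE eqxx.
move: ps; rewrite pairwise_cons => /andP[vs ps].
case: (boolP (lex_lt u v)) => [uv|vu].
  have [|t nt tE] := IH _ (lyndon_cat lu lv uv).
    by split=> // w ws; apply: ls; rewrite inE ws orbT.
  by exists t; rewrite // tE /= catA.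
exists [:: u, v & s] => //; split=> [w|].
  by rewrite inE => /predU1P[->//|]; apply: ls.
rewrite !pairwise_cons vs ps !andbT /=; apply/andP; split=> //.
by apply/allP => w /(allP vs) wv; apply: lex_le_trans wv vu.
Qed.

(** The existence half of the Chen-Fox-Lyndon theorem. *)
Lemma lyndon_factorization w :
  exists2 s, nonincreasing_lyndon s & flatten s = w.
Proof.
elim: w => [|a w [s ns <-]]; first by exists [::].
exact: nonincreasing_lyndon_insert (lyndon_letter a) ns.
Qed.

(** The last factor is a suffix bounded by the first factor, whereas proper suffixes of a Lyndon
    word exceed it. This clash drives the next two lemmas. *)
Lemma nonincreasing_lyndon_last u s : nonincreasing_lyndon (u :: s) ->
  exists x v, [/\ u ++ flatten s = x ++ v, lyndon v & lex_le v u].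
Proof.
case/lastP: s => [|s v] [ls ps].
  exists [::], u; split; rewrite /= ?cats0 ?lex_lexx //.
  by apply: ls; rewrite inE eqxx.
have vs : v \in rcons s v by rewrite mem_rcons inE eqxx.
exists (u ++ flatten s), v; split.
- by rewrite flatten_rcons catA.
- by apply: ls; rewrite inE vs orbT.
- by move: ps; rewrite pairwise_cons => /andP[/allP/(_ v vs)].
Qed.

(* In a standard factorization the left factor is in fact the longest proper
   Lyndon prefix, whether or not the complementary suffix is Lyndon. *)
Lemma standard_factorization_prefix w u v x y : lyndon w ->
  standard_factorization w u v -> lyndon x -> y <> [::] -> w = x ++ y ->
  (size x <= size u)%N.
Proof.
move=> lw [_ _ _ umax]; case: (lyndon_factorization y) => s ns <-.
elim: s x ns => [|z s IH] x ns lx //= s0 wE.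
have lz : lyndon z by apply: ns.1; rewrite inE eqxx.
case: s s0 wE IH ns => [|z' s] s0 wE IH ns.
  by rewrite cats0 in wE; apply: umax wE lx lz.
(* If [x < z], then [x ++ z] is a longer Lyndon prefix. Otherwise the last factor [q] satisfies
   [q <= z <= x <= w], while [w < q] because [w] is Lyndon. *)
case: (boolP (lex_lt x z)) => [xz|zx].
  apply: leq_trans (IH (x ++ z) _ _ _ _).
  - by rewrite size_cat leq_addr.
  - case: ns => ls; rewrite pairwise_cons => /andP[_ ps]; split=> // t ts.
    by apply: ls; rewrite inE ts orbT.
  - exact: lyndon_cat.
  - have lz' : lyndon z' by apply: ns.1; rewrite !inE eqxx orbT.
    by apply: cat_neq0l; apply: lyndon_neq0.
  - by rewrite -catA.
have [p [q [E lq qz]]] := nonincreasing_lyndon_last ns.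
have wq : lex_lt w q.
  rewrite wE E catA; apply: lyndon_lt_suffix (lyndon_neq0 lq).
    by rewrite -catA -E -wE.
  exact: cat_neq0l (lyndon_neq0 lx).
have xw : lex_le x w by rewrite wE lex_le_cat.
have qx : lex_le q x by apply: lex_le_trans qz zx.
by have := lex_lt_le_trans wq (lex_le_trans qx xw); rewrite lex_ltxx.
Qed.

(** Suppose a left factor [x = u ++ s] were longer. The first Lyndon factor [s1] of [s] is a proper
    Lyndon prefix of [v], hence a prefix of [p], so [s1 <= p <= u]. The last Lyndon factor of [s] is
    then a proper suffix of [x] that is at most [u <= x], so [x] is not Lyndon. *)
Lemma standard_factorization_lyndon_cat u v : lyndon u -> lyndon v ->
  lex_lt u v ->
  (forall p q, standard_factorization v p q -> lex_le p u) ->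
  (size v = 1%N \/ exists p q, standard_factorization v p q) ->
  standard_factorization (u ++ v) u v.
Proof.
move=> lu lv uv pu sv; split=> // x y uvE lx ly.
rewrite leqNgt; apply/negP => ux.
have [s xE vE] := cat_eq_cat uvE (ltnW ux).
have s0 : s <> [::] by move=> s0; move: ux; rewrite xE s0 cats0 ltnn.
case: sv => [v1|[p [q vpq]]].
  move: v1; rewrite vE size_cat.
  by case: (s) s0 (y) (lyndon_neq0 ly) => [|? ?] // _ [|? ?] //=; rewrite addnS.
case: (lyndon_factorization s) => l nl lE.
case: l lE nl => [|s1 l] lE nl; first by case: s0.
have ls1 : lyndon s1 by apply: nl.1; rewrite inE eqxx.
have s1p : lex_le s1 p.
  have s1v : v = s1 ++ (flatten l ++ y) by rewrite vE -lE /= catA.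
  have y0 : flatten l ++ y <> [::].
    by case: (flatten l); [apply: lyndon_neq0|].
  have vE' : v = p ++ q by case: vpq.
  have s1p := standard_factorization_prefix lv vpq ls1 y0 s1v.
  have [r -> _] := cat_eq_cat (etrans (esym s1v) vE') s1p.
  exact: lex_le_cat.
have [t [m [E lm ms1]]] := nonincreasing_lyndon_last nl.
have xm : lex_lt x m.
  rewrite xE -lE /= E catA; apply: lyndon_lt_suffix (lyndon_neq0 lm).
    by rewrite -catA -E -[s1 ++ _]/(flatten (s1 :: l)) lE -xE.
  exact: cat_neq0l (lyndon_neq0 lu).
have ux' : lex_le u x by rewrite xE lex_le_cat.
have mu := lex_le_trans ms1 (lex_le_trans s1p (pu _ _ vpq)).
by have := lex_lt_le_trans xm (lex_le_trans mu ux'); rewrite lex_ltxx.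
Qed.

End Words.

(** * The Lyndon bracketing and the Hall condition *)

Section LyndonBasis.
Variables (d : Order.disp_t) (X : orderType d).
Implicit Types (u v w e : seq X) (a b c t : Br X).

Lemma foliage_br_graph w t : br_graph w t -> foliage t = w.
Proof.
by elim=> {w t} [//|w u v t1 t2 _ [-> _ _ _] _ fu _ fv] /=; rewrite fu fv.
Qed.

Lemma br_graph_inv w t : br_graph w t ->
  match t with
  | Leaf x => w = [:: x]
  | Node t1 t2 => exists u v, [/\ lyndon w, standard_factorization w u v,
      br_graph u t1 & br_graph v t2]
  end.
Proof. by case=> // {}w u v t1 t2 lw sf g1 g2; exists u, v. Qed.

Lemma standard_factorization_letter x u v :
  ~ standard_factorization [:: x] u v.
Proof.
case=> /(congr1 size); rewrite size_cat => E lu lv _; move: E.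
by case: u lu v lv => [|y u] [] // _ _ [|z v] [] //= _ _; rewrite addnS.
Qed.

Lemma lyndon_basisP t :
  lyndon_basis t <-> lyndon (foliage t) /\ br_graph (foliage t) t.
Proof.
split=> [[w lw wt]|[lt gt]]; last by exists (foliage t).
by rewrite (foliage_br_graph wt).
Qed.

Lemma lyndon_basis_lyndon t : lyndon_basis t -> lyndon (foliage t).
Proof. by case/lyndon_basisP. Qed.

Lemma lyndon_basis_Node a b : lyndon_basis (Node a b) <->
  [/\ lyndon_basis a, lyndon_basis b, lyndon (foliage a ++ foliage b) &
      standard_factorization (foliage a ++ foliage b) (foliage a) (foliage b)].
Proof.
split=> [[w lw wt]|[/lyndon_basisP[_ ga] /lyndon_basisP[_ gb] lw sf]].
  have [u [v [_ sf ga gb]]] := br_graph_inv wt.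
  rewrite (foliage_br_graph ga) (foliage_br_graph gb).
  case: (sf) => wE lu lv _; rewrite -wE; split=> //; last by exists v.
  by exists u.
by exists (foliage a ++ foliage b) => //; apply: br_factor sf ga gb.
Qed.

Lemma standard_factorization_inj w u v u' v' :
  standard_factorization w u v -> standard_factorization w u' v' ->
  u = u' /\ v = v'.
Proof.
move=> [wE lu lv um] [wE' lu' lv' um'].
have uu' : size u = size u'.
  by apply/eqP; rewrite eqn_leq (um _ _ wE' lu' lv') (um' _ _ wE lu lv).
by move/eqP: wE'; rewrite wE eqseq_cat // => /andP[/eqP-> /eqP->].
Qed.

Lemma lyndon_basis_foliage_inj a b : lyndon_basis a -> lyndon_basis b ->
  foliage a = foliage b -> a = b.
Proof.
move=> /lyndon_basisP[_ ga] /lyndon_basisP[_ gb] ab; rewrite -ab in gb.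
move: {ab} (foliage a) ga gb => w ga gb.
elim: ga b gb => [x|{}w u v t1 t2 lw sf _ IH1 _ IH2] [y|b1 b2] /br_graph_inv.
- by case=> ->.
- by move=> [u [v [_ /standard_factorization_letter]]].
- by move=> wE; rewrite wE in sf; case: (standard_factorization_letter sf).
move=> [u' [v' [_ sf' g1 g2]]].
have [uE vE] := standard_factorization_inj sf sf'.
by rewrite -uE -vE in g1 g2; rewrite (IH1 _ g1) (IH2 _ g2).
Qed.

(* [lambda(t) <= e], read as true when [t] is a letter. *)
Definition lambda_le t e :=
  if t is Node p _ then lex_le (foliage p) e else true.

(** If [a < lambda(b)], joining [lambda(b)] to [a] would give a longer Lyndon left factor. *)
Lemma lyndon_basis_Node_lambda a b : lyndon_basis (Node a b) ->
  lambda_le b (foliage a).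
Proof.
case: b => // p q /lyndon_basis_Node[Ba /lyndon_basis_Node[Bp Bq _ _] /= lw sf].
apply/negP => ap.
case: sf => _ la _ /(_ (foliage a ++ foliage p) (foliage q)).
rewrite catA => /(_ erefl (lyndon_cat la (lyndon_basis_lyndon Bp) ap)).
move=> /(_ (lyndon_basis_lyndon Bq)); rewrite size_cat -[X in (_ <= X)%N]addn0.
by rewrite leq_add2l; case: (foliage p) (lyndon_neq0 (lyndon_basis_lyndon Bp)).
Qed.

Lemma lyndon_basis_Node_lt a b : lyndon_basis (Node a b) ->
  lex_lt (foliage a) (foliage b).
Proof.
case/lyndon_basis_Node=> Ba Bb lw _.
apply: lex_le_lt_trans (lex_le_cat _ (foliage b)) _.
by apply: lyndon_lt_suffix lw _ _; apply: lyndon_neq0; apply: lyndon_basis_lyndon.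
Qed.

Lemma lyndon_basis_Node_of_lambda a b : lyndon_basis a -> lyndon_basis b ->
  br_lt a b -> lambda_le b (foliage a) -> lyndon_basis (Node a b).
Proof.
move=> Ba Bb ab lba; have la := lyndon_basis_lyndon Ba.
have lb := lyndon_basis_lyndon Bb.
apply/lyndon_basis_Node; split=> //; first exact: lyndon_cat.
apply: standard_factorization_lyndon_cat => //.
  case: b Bb lba {ab lb} => [x|p q] Bb lba p' q' sf; first by
    case: (standard_factorization_letter sf).
  have [_ _ _ sf'] := (lyndon_basis_Node p q).1 Bb.
  by have [-> _] := standard_factorization_inj sf sf'.
case: b Bb {lba ab lb} => [x|p q] Bb; [by left | right].
by exists (foliage p), (foliage q); case/lyndon_basis_Node: Bb.
Qed.

End LyndonBasis.

(** * Identities in a Lie algebra *)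

Section LieAlgebra.
Variables (K : numFieldType) (L : lieAlgType K).
Implicit Types x y z : L.

Lemma lieC x y : lie x y = - lie y x.
Proof.
have lD a b c : lie (a + b) c = lie a c + lie b c.
  by have := lie_linearl c 1 a b; rewrite !scale1r.
have lD' a b c : lie a (b + c) = lie a b + lie a c.
  by have := lie_linearr a 1 b c; rewrite !scale1r.
apply/eqP; rewrite -addr_eq0; have := lie_alternating (x + y).
by rewrite lD !lD' !lie_alternating add0r addr0 => ->.
Qed.

Lemma lieN x y : lie x (- y) = - lie x y.
Proof.
have := lie_linearr x (-1) y 0; rewrite addr0 !scaleN1r => ->.
have := lie_linearr x (-1) 0 0; rewrite addr0 !scaleN1r oppr0 => ->.
by rewrite addNr addr0.
Qed.

Lemma lie_derivation x y z :
  lie x (lie y z) = lie (lie x y) z + lie y (lie x z).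
Proof.
have /eqP := lie_jacobi x y z; rewrite -addrA addr_eq0 => /eqP->.
by rewrite (lieC z (lie x y)) (lieC z x) lieN opprD !opprK addrC.
Qed.

End LieAlgebra.

(** * Combinations of brackets with bounded l^1 weight *)

Section L1Span.
Variables (K : numFieldType) (X : choiceType) (L : lieAlgType K) (i : X -> L).
Implicit Types (P Q : Br X -> Prop) (N M : K) (x y : L) (s : seq (K * Br X)).

(** Brackets may repeat in the list, so sums are concatenations and uniqueness of coordinates does
    not enter. *)
Definition l1_span P N x := exists s,
  [/\ forall p, p \in s -> P p.2, x = \sum_(p <- s) p.1 *: ev i p.2 &
      \sum_(p <- s) `|p.1| <= N].

Lemma l1_span0 P : l1_span P 0 0.
Proof. by exists [::]; split; rewrite ?big_nil. Qed.

Lemma l1_span_ev P t : P t -> l1_span P 1 (ev i t).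
Proof.
move=> Pt; exists [:: (1, t)]; split; rewrite ?big_seq1 ?scale1r ?normr1 //.
by move=> p; rewrite inE => /eqP->.
Qed.

Lemma l1_spanD P N M x y :
  l1_span P N x -> l1_span P M y -> l1_span P (N + M) (x + y).
Proof.
move=> [s [Ps -> sN]] [s' [Ps' -> sM]]; exists (s ++ s'); split.
- by move=> p; rewrite mem_cat => /orP[/Ps|/Ps'].
- by rewrite big_cat.
- by rewrite big_cat lerD.
Qed.

Lemma l1_spanZ P N k x : l1_span P N x -> l1_span P (`|k| * N) (k *: x).
Proof.
move=> [s [Ps -> sN]]; exists [seq (k * p.1, p.2) | p <- s]; split.
- by move=> p /mapP[q /Ps Pq ->].
- by rewrite big_map scaler_sumr; apply: eq_bigr => p _; rewrite scalerA.
- rewrite big_map /= (eq_bigr (fun p => `|k| * `|p.1|)) => [|p _].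
    by rewrite -mulr_sumr ler_wpM2l.
  by rewrite normrM.
Qed.

Lemma l1_span_le P Q N M x : (forall t, P t -> Q t) -> N <= M ->
  l1_span P N x -> l1_span Q M x.
Proof.
move=> PQ NM [s [Ps xE sN]]; exists s; split=> //.
  by move=> p /Ps /PQ.
exact: le_trans NM.
Qed.

Lemma l1_span_linear P Q N M (f : L -> L) x : linear f -> 0 <= M ->
  (forall t, P t -> l1_span Q M (f (ev i t))) ->
  l1_span P N x -> l1_span Q (N * M) (f x).
Proof.
move=> lf M0 fP [s [Ps -> sN]].
(* The exact weight of the list replaces [N], which makes the induction on the list additive. *)
apply: (@l1_span_le Q Q ((\sum_(p <- s) `|p.1|) * M)) => //.
  exact: ler_wpM2r.
elim: s Ps {sN} => [|p s IH] Ps.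
  rewrite !big_nil mul0r; have := lf (-1) 0 0.
  by rewrite scaleN1r oppr0 addr0 scaleN1r addNr => ->; apply: l1_span0.
rewrite !big_cons lf mulrDl; apply: l1_spanD.
  by apply/l1_spanZ/fP/Ps; rewrite inE eqxx.
by apply: IH => q qs; apply: Ps; rewrite inE qs orbT.
Qed.

End L1Span.

(** * Brackets of two elements of the Lyndon basis *)

Section Bracket.
Variables (K : numFieldType) (d : Order.disp_t) (X : orderType d).
Variables (L : lieAlgType K) (i : X -> L).
Implicit Types (a b c t : Br X).

(* The properties of the support of [[a, b]], for a < b in the basis, that make
   the recursion close; the last two say lambda(c) <= max(a, lambda(b)), and
   that c stays strictly below any e >= lambda(b) which a is strictly below. *)
Definition bracket_support a b c :=
  [/\ lyndon_basis c, lex_ll (foliage c) (foliage b),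
      forall e, lex_le (foliage a) e -> lambda_le b e -> lambda_le c e &
      forall e, lex_ll (foliage a) e -> lambda_le b e -> lex_ll (foliage c) e].

Lemma leaves_gt0 (t : Br X) : (0 < leaves t)%N.
Proof. by elim: t => //= t1 IH1 t2 IH2; rewrite addn_gt0 IH1. Qed.

Lemma size_foliage (t : Br X) : size (foliage t) = leaves t.
Proof. by elim: t => //= t1 IH1 t2 IH2; rewrite size_cat IH1 IH2. Qed.

(** The word of [Node a b] is below that of [b] and longer, so a letter decides. The other bounds
    come from [a], which is both its lambda and its prefix. *)
Lemma bracket_support_Node a b : lyndon_basis a -> lyndon_basis b ->
  br_lt a b -> lambda_le b (foliage a) -> bracket_support a b (Node a b).
Proof.
move=> Ba Bb ab lba; split=> [||e //|e ae _] /=.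
- exact: lyndon_basis_Node_of_lambda.
- apply: lex_ll_size.
    by apply: lyndon_cat_lt => //; apply: lyndon_basis_lyndon.
  by rewrite size_cat -[X in (X < _)%N]add0n ltn_add2r size_foliage leaves_gt0.
- exact: lex_ll_catl.
Qed.

Lemma lie_l1_span a b : lyndon_basis a -> lyndon_basis b -> br_lt a b ->
  l1_span i (bracket_support a b) (2 ^+ (leaves b).-1) (lie (ev i a) (ev i b)).
Proof.
elim: b a => [x|b1 IH1 b2 IH2] a Ba Bb ab.
  rewrite expr0 -[lie _ _]/(ev i (Node a (Leaf x))).
  by apply: l1_span_ev; apply: bracket_support_Node.
case: (boolP (lambda_le (Node b1 b2) (foliage a))) => [lba|/negbNE ab1].
  apply: (@l1_span_le _ _ _ _ (bracket_support a (Node b1 b2)) _ 1) => //.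
    by rewrite exprn_ege1 ?ler1n.
  rewrite -[lie _ _]/(ev i (Node a (Node b1 b2))).
  by apply: l1_span_ev; apply: bracket_support_Node.
have [B1 B2 _ _] := (lyndon_basis_Node _ _).1 Bb.
have b12 := lyndon_basis_Node_lt Bb; have lb21 := lyndon_basis_Node_lambda Bb.
have lb11 : lambda_le b1 (foliage b1).
  by case: (b1) => //= p q; apply: lex_le_cat.
have pow_ge0 n : 0 <= 2 ^+ n :> K by rewrite exprn_ge0 ?ler0n.
(* The extra factor 2 pays for the two Jacobi terms, each of which costs the product of the two
   remaining powers. *)
have -> : (leaves (Node b1 b2)).-1 = ((leaves b1).-1 + (leaves b2).-1).+1.
  move: (leaves_gt0 b1) (leaves_gt0 b2) => /=.
  by case: (leaves b1) (leaves b2) => [|n] [|m] // _ _; rewrite addSn addnS.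
rewrite exprS exprD mulr_natl mulr2n [in X in _ + X]mulrC /= lie_derivation.
apply: l1_spanD.
  apply: (l1_span_linear (f := fun y => lie y (ev i b2)) (lie_linearl _)
            (pow_ge0 _) _ (IH1 a Ba B1 ab1)).
  move=> c [Bc cb1 lc cll].
  have cb2 : br_lt c b2 by apply: lex_lt_trans b12; apply: lex_llW.
  apply: l1_span_le (lexx _) (IH2 c Bc B2 cb2).
  (* The last support property of [t], taken at [e = b1], applies since [c] is below [b1] by a
     letter and [lambda(b2) <= b1]. *)
  move=> t [Bt tb2 lt tll]; have tb1 := tll _ cb1 lb21; split=> //=.
  - exact: lex_ll_catr.
  - move=> e ae b1e; apply: lt.
      exact: lex_le_trans (lex_ltW (lex_llW cb1)) b1e.
    by case: (b2) lb21 => //= p _ pb1; apply: lex_le_trans b1e.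
  - by move=> e ae b1e; apply: lex_ll_le_trans b1e.
have ab2 : br_lt a b2 by apply: lex_lt_trans b12.
apply: (l1_span_linear (f := lie (ev i b1)) (lie_linearr _) (pow_ge0 _)
          _ (IH2 a Ba B2 ab2)).
move=> c [Bc cb2 lc cll].
have lcb1 : lambda_le c (foliage b1) by apply: lc => //; apply: lex_ltW.
case: (lex_lt_total (foliage c) (foliage b1)) => [cb1|cb1|b1c].
- rewrite lieC -scaleN1r -[2 ^+ _]mul1r -[X in X * _](normrN1 K).
  apply: l1_spanZ.
  apply: l1_span_le (lexx _) (IH1 c Bc B1 cb1).
  move=> t [Bt tb1 lt tll]; split=> //=.
  + exact: lex_ll_catr.
  + move=> e ae b1e; apply: lt; first exact: lex_le_trans (lex_ltW cb1) b1e.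
    by case: (b1) lb11 b1e => //= p q pb1 b1e; apply: lex_le_trans b1e.
  + by move=> e ae b1e; apply: lex_ll_le_trans b1e.
- rewrite (lyndon_basis_foliage_inj Bc B1 cb1) lie_alternating.
  by apply: (@l1_span_le _ _ _ _ (bracket_support a (Node b1 b2)) _ 0) => //;
    apply: l1_span0.
- apply: (@l1_span_le _ _ _ _ (bracket_support a (Node b1 b2)) _ 1) => //.
    by rewrite exprn_ege1 ?ler1n.
  rewrite -[lie _ _]/(ev i (Node b1 c)).
  apply: l1_span_ev; split=> [||e //|e ae b1e] /=.
  + exact: lyndon_basis_Node_of_lambda.
  + by rewrite lex_ll_cat2l.
  (* From [b1 <= e] alone, [b1] could be a prefix of [e]. If a letter decided [a < b1], the last
     support property of [c] at [e = b1] would give [c < b1]. So [a] is a prefix of [b1], and the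
     letter deciding [a < e] also decides [b1 < e]. *)
  + apply: lex_ll_catl; case: (lex_ltP ab1) => [ab1'|[y y0 b1E]].
      have cb1 := lex_llW (cll _ ab1' lb21).
      by case: (lex_lt_asym cb1 b1c).
    by rewrite b1E; apply: lex_ll_catl.
Qed.

End Bracket.

(** * Leading words and linear independence *)

Section LeadingWord.
Variables (K : numFieldType) (d : Order.disp_t) (X : orderType d).
Implicit Types (u v w : seq X) (f g : series K X) (t c : Br X).

Definition leading_word w f :=
  [/\ vanishes_off (size w) f, f w = 1 & forall v, lex_lt v w -> f v = 0].

(** By homogeneity only the splitting [w = p ++ q] with [p] as long as [u] contributes. If
    [w < u ++ v], then [p < u], or [p = u] and [q < v]. *)
Lemma leading_word_conv u v f g : leading_word u f -> leading_word v g ->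
  leading_word (u ++ v) (conv f g).
Proof.
move=> [fu f1 f0] [gv g1 g0]; split.
- by rewrite size_cat; apply: conv_vanishes_off.
- by rewrite (conv_cat _ _ fu) // f1 g1 mulr1.
move=> w wuv; case: (ltnP (size w) (size u)) => [|uw].
  exact: conv_short fu.
move: wuv; rewrite -(cat_take_drop (size u) w).
rewrite (conv_cat _ _ fu) ?size_takel //.
move: (take _ w) (size_takel uw) (drop _ w) => p pu q puv.
case: (lex_lt_total p u) => [/f0->|pE|]; first by rewrite mul0r.
  by rewrite pE lex_lt_cat2l in puv; rewrite (g0 _ puv) mulr0.
case/lex_ltP => [/(lex_ll_cat v q)/lex_llW/(lex_lt_asym puv)//|[y y0 pE]].
by move: pu; rewrite pE size_cat -[RHS]addn0 => /addnI/size0nil.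
Qed.

(** The product in the other order has leading word [v ++ u], too large to interfere. *)
Lemma leading_word_commutator u v f g : leading_word u f -> leading_word v g ->
  lex_lt (u ++ v) (v ++ u) -> leading_word (u ++ v) (commutator f g).
Proof.
move=> lf lg uv; have [fg fg1 fg0] := leading_word_conv lf lg.
have [gf _ gf0] := leading_word_conv lg lf.
split=> [w wuv||w wuv]; rewrite /commutator.
- by rewrite fg // gf ?subr0 // size_cat addnC -size_cat.
- by rewrite fg1 gf0 // subr0.
- by rewrite fg0 // gf0 ?subr0 //; apply: lex_lt_trans uv.
Qed.

Definition letter (x : X) : series K X := fun w => (w == [:: x])%:R.

Lemma leading_word_ev w t : br_graph w t -> leading_word w (ev letter t).
Proof.
elim=> {w t} [x|w u v t1 t2 [_ lw] [wE lu lv _] _ IH1 _ IH2] /=.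
  split=> [w||w wx]; rewrite /letter ?eqxx //.
    by case: (w =P _) => // ->; rewrite eqxx.
  by case: (w =P _) wx => // ->; rewrite lex_ltxx.
rewrite wE; apply: leading_word_commutator => //; rewrite -wE.
by apply: lw wE; apply: lyndon_neq0.
Qed.

Lemma lex_min_exists (T : eqType) (f : T -> seq X) (s : seq T) : s <> [::] ->
  exists2 m, m \in s & forall z, z \in s -> lex_le (f m) (f z).
Proof.
elim: s => // x [|y s] IH _.
  exists x; rewrite ?inE // => t; rewrite inE => /eqP->; exact: lex_lexx.
have [//|m ms mmin] := IH.
case: (boolP (lex_lt (f x) (f m))) => [xm|mx].
  exists x; rewrite ?inE ?eqxx // => t; rewrite in_cons => /predU1P[->|/mmin mt].
    exact: lex_lexx.
  exact: lex_le_trans (lex_ltW xm) mt.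
exists m; first by rewrite in_cons ms orbT.
by move=> t; rewrite in_cons => /predU1P[->|/mmin].
Qed.

Lemma series_sumE (I : Type) (s : seq I) (F : I -> series K X) w :
  (\sum_(j <- s) F j) w = \sum_(j <- s) F j w.
Proof. by elim: s => [|j s IH]; rewrite ?big_nil // !big_cons -IH. Qed.

(** Triangularity: among the brackets with nonzero coefficient, take the one with least word and
    evaluate the relation at that word. Only its own coefficient remains. *)
Lemma ev_letter_free (r : seq (Br X)) (gam : Br X -> K) : uniq r ->
  (forall c, c \in r -> lyndon_basis c) ->
  \sum_(c <- r) gam c *: ev letter c = 0 -> forall c, c \in r -> gam c = 0.
Proof.
move=> ur rB sum0 c cr; apply/eqP; apply: contraT => gc.
have [|m] := @lex_min_exists _ (@foliage X) [seq c <- r | gam c != 0].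
  by move=> s0; have := mem_filter (fun c => gam c != 0) c r; rewrite s0 gc cr.
rewrite mem_filter => /andP[gm mr] mmin; case/negP: gm; apply/eqP.
have := congr1 (fun f : series K X => f (foliage m)) sum0.
rewrite series_sumE (bigD1_seq m) //= big1_seq => [|t /andP[tm tr]].
  rewrite addr0; have [_ mE] := (lyndon_basisP m).1 (rB _ mr).
  have [_ m1 _] := leading_word_ev mE.
  by rewrite -[LHS]/(gam m * ev letter m (foliage m)) m1 mulr1.
rewrite -[LHS]/(gam t * ev letter t (foliage m)).
have [->|gt] := eqVneq (gam t) 0; first exact: mul0r.
have [_ tE] := (lyndon_basisP t).1 (rB _ tr).
have [_ _ ->] := leading_word_ev tE; first exact: mulr0.
have : lex_le (foliage m) (foliage t) by apply: mmin; rewrite mem_filter gt.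
case/lex_le_eqVlt => // mtE; case/eqP: tm.
by apply: lyndon_basis_foliage_inj => //; apply: rB.
Qed.

Lemma lie_morphism_ev (L M : lieAlgType K) (i : X -> L) (phi : L -> M) t :
  lie_morphism phi -> phi (ev i t) = ev (phi \o i) t.
Proof. by case=> _ lphi; elim: t => //= t1 <- t2 <-. Qed.

(** The universal property sends a relation in [L] to the same relation among power series. *)
Lemma lyndon_basis_free (L : lieAlgType K) (i : X -> L) (r : seq (Br X))
    (gam : Br X -> K) : is_free_lie_algebra i -> uniq r ->
  (forall c, c \in r -> lyndon_basis c) ->
  \sum_(c <- r) gam c *: ev i c = 0 -> forall c, c \in r -> gam c = 0.
Proof.
move=> /(_ (series K X) letter) [phi [[mphi phiE] _]] ur rB sum0.
apply: ev_letter_free => //.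
have phi0 : phi 0 = 0.
  by have := mphi.1 (-1) 0 0; rewrite scaleN1r oppr0 addr0 scaleN1r addNr.
have phi_iE : phi \o i = letter by apply/funext.
rewrite -[RHS]phi0 -sum0.
elim: (r) => [|c s IH]; first by rewrite !big_nil phi0.
by rewrite !big_cons IH mphi.1 (lie_morphism_ev i c mphi) phi_iE.
Qed.

End LeadingWord.

(** * From weighted combinations to coordinates *)

Section BasisNorm.
Variables (K : numFieldType) (X : choiceType) (L : lieAlgType K) (i : X -> L).
Variable B : set (Br X).
Implicit Types (s : seq (K * Br X)) (r : seq (Br X)).
Implicit Types (alpha : {fsfun Br X -> K with 0}).

Hypothesis ev_free : forall r (gam : Br X -> K), uniq r ->
  (forall c, c \in r -> B c) ->
  \sum_(c <- r) gam c *: ev i c = 0 -> forall c, c \in r -> gam c = 0.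

Lemma sum_finsupp (V : nmodType) alpha r (F : Br X -> V) : uniq r ->
  {subset finsupp alpha <= r} -> (forall c, alpha c = 0 -> F c = 0) ->
  \sum_(c <- finsupp alpha) F c = \sum_(c <- r) F c.
Proof.
move=> ur sub F0; rewrite [RHS](bigID (mem (finsupp alpha))) /=.
rewrite [X in _ + X]big1 => [|c]; last by move/fsfun_dflt/F0.
rewrite addr0 -[RHS]big_filter; apply: perm_big; apply: uniq_perm.
- exact: fset_uniq.
- exact: filter_uniq.
- by move=> c; rewrite mem_filter; case: (boolP (c \in _)) => //= /sub.
Qed.

Lemma sum_fiber (V : nmodType) s r (F : K * Br X -> V) : uniq r ->
  {subset [seq p.2 | p <- s] <= r} ->
  \sum_(c <- r) \sum_(p <- s | p.2 == c) F p = \sum_(p <- s) F p.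
Proof.
move=> ur sub; rewrite (exchange_big_dep predT) //= big_seq [RHS]big_seq.
apply: eq_bigr => p ps; rewrite (eq_bigl (pred1 p.2)) => [|c]; last exact: eq_sym.
by rewrite -big_filter filter_pred1_uniq ?big_seq1 //; apply/sub/map_f.
Qed.

Definition collect s (c : Br X) : K := \sum_(p <- s | p.2 == c) p.1.

Lemma sum_collect s r : uniq r -> {subset [seq p.2 | p <- s] <= r} ->
  \sum_(c <- r) collect s c *: ev i c = \sum_(p <- s) p.1 *: ev i p.2.
Proof.
move=> ur sub; rewrite -(sum_fiber _ ur sub); apply: eq_bigr => c _.
by rewrite scaler_suml; apply: eq_bigr => p /eqP->.
Qed.

Lemma basis_norm_le (u : L) (N : K) : l1_span i B N u ->
  (basis_norm i B u <= N%:E)%E.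
Proof.
move=> [s [sB -> sN]]; rewrite /basis_norm; case: pselect => [h|[]]; last first.
  (* The combination itself, with repeated brackets collected, is an expansion, so the value [+oo]
     is excluded. *)
  pose r := undup [seq p.2 | p <- s].
  have rs c : (c \in r) = (c \in [seq p.2 | p <- s]) by rewrite mem_undup.
  exists [fsfun c in seq_fset tt r => collect s c]; split=> [c|].
    rewrite mem_finsupp fsfun_fun; case: ifP => [|_]; last by rewrite eqxx.
    by rewrite seq_fsetE rs => /mapP[p /sB Bp ->].
  rewrite (sum_finsupp (undup_uniq _ : uniq r)) => [|c|c ->]; last exact: scale0r.
    rewrite -(@sum_collect _ r) ?undup_uniq // => [|c]; last by rewrite rs.
    by apply: eq_big_seq => c cr; rewrite fsfun_fun seq_fsetE cr.
  by rewrite mem_finsupp fsfun_fun seq_fsetE; case: ifP; rewrite ?eqxx.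
case: (cid h) => alpha [aB aE] /=; rewrite lee_fin; apply: le_trans sN.
(* The chosen expansion and the collected combination are compared on a common list. Freeness
   identifies them, and collecting cannot increase the weight, by the triangle inequality. *)
pose r := undup (finsupp alpha ++ [seq p.2 | p <- s]).
have ur : uniq r by apply: undup_uniq.
have ar : {subset finsupp alpha <= r}.
  by move=> c ca; rewrite mem_undup mem_cat ca.
have sr : {subset [seq p.2 | p <- s] <= r}.
  by move=> c cs; rewrite mem_undup mem_cat cs orbT.
rewrite (sum_finsupp ur ar) => [|c ->]; last exact: normr0.
rewrite -(sum_fiber _ ur sr) big_seq [leRHS]big_seq; apply: ler_sum => c cr.
suff /eqP : alpha c - collect s c = 0.
  by rewrite subr_eq0 => /eqP->; apply: ler_norm_sum.
apply: (ev_free (gam := fun t => alpha t - collect s t) ur _ _ cr) => [t|].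
  by rewrite mem_undup mem_cat => /orP[/aB//|/mapP[p /sB Bp ->//]].
rewrite (eq_bigr (fun t => alpha t *: ev i t - collect s t *: ev i t)) => [|t _].
  rewrite sumrB sum_collect // aE (sum_finsupp ur ar) ?subrr // => t ->.
  exact: scale0r.
exact: scalerBl.
Qed.

End BasisNorm.

Theorem theorem1p6 (R : realType) (K : numFieldType)
    (hK : real_or_complex R K)
    (d : Order.disp_t) (X : orderType d) (hX : exists x y : X, x <> y)
    (L : lieAlgType K) (i : X -> L) (hL : is_free_lie_algebra i)
    (a b : Br X) (ha : lyndon_basis a) (hb : lyndon_basis b)
    (hab : br_lt a b) :
  (basis_norm i (@lyndon_basis d X) (lie (ev i a) (ev i b))
     <= (2 ^+ (leaves b).-1)%:E)%E.
Proof.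
apply: basis_norm_le => [r gam|]; first exact: lyndon_basis_free hL.
by apply: l1_span_le (lexx _) (lie_l1_span i ha hb hab) => t [].
Qed.
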